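(* Let $f:\{0,1\}^n\to\{0,1\}$ be a monotone function with $C(f)\le k$ and let $x^\star\in\{0,1\}^n$. Then Algorithm 2 (described in the context) iterates its main loop $O(k)$ times and with high probability outputs a certificate for $f$'s value on $x^\star$ of size $O(k^4)$.
   Context: A set $S\subseteq[n]$ is a certificate for $f$'s value on $x$ if $f(y)=f(x)$ for all $y$ agreeing with $x$ on $S$; $C(f)$ is the maximum over $x$ of the minimum size of such a certificate. $f$ is monotone if $x\le y$ coordinatewise implies $f(x)\le f(y)$. Algorithm 1 is a randomized subroutine which, given query access to a monotone $g$ with $C(g)\le k$, with high probability returns a set $s$ of size $O(k^3)$ of coordinates together with a bit $b$ such that $g$ with all coordinates in $s$ fixed to $b$ is constant. (Concretely: $S\leftarrow\varnothing$; while $g$ nonconstant: find an $O(1/k^3)$-accurate estimate $p$ of the critical probability of $g$ (the $p$ with $\mathbb{E}_{x\sim\{0,1\}^n_p}[g(x)]=1/2$, $\{0,1\}^n_p$ the $p$-biased product distribution), estimate all $p$-biased rerandomized influences $2\Pr_p[g(x)\ne g(x^{\sim i})]$ to accuracy $O(1/k^2)$, add the coordinate $i$ with largest estimate to $S$, and restrict $g\leftarrow g_{x_i=b}$ with $b=0$ if $p\ge 1/2$ and $b=1$ otherwise.) Algorithm 2 (input: monotone $f$, input $x^\star$): $S\leftarrow\varnothing$; while $f$ is nonconstant: let $s$ be the output of Algorithm 1 on $f$; $S\leftarrow S\cup s$; restrict $f$ by setting $x_i=x^\star_i$ for all $i\in s$; finally return $S$. ''With high probability'' means with probability at least $1-1/\mathrm{poly}(n)$.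 *)

(* Defs.v *)
From mathcomp Require Import all_boot all_order all_algebra.
From mathcomp Require Import classical_sets reals.
Set Implicit Arguments.
Unset Strict Implicit.
Unset Printing Implicit Defensive.
Import Order.TTheory GRing.Theory Num.Theory.
Local Open Scope ring_scope.

(** ** Boolean functions *)

Definition cube (n : nat) := {ffun 'I_n -> bool}.
Definition boolfun (n : nat) := cube n -> bool.

Definition monotone n (f : boolfun n) : Prop :=
  forall x y : cube n, (forall i, (x i <= y i)%N) -> (f x <= f y)%N.

Definition is_constant n (f : boolfun n) : bool :=
  [forall x, forall y, f x == f y].

Definition is_certificate n (f : boolfun n) (x : cube n) (S : {set 'I_n}) :
    bool :=
  [forall y : cube n, [forall i in S, y i == x i] ==> (f y == f x)].

(* The full set of coordinates certifies every input, so it seeds the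
   minimisation. *)
Definition cert_complexity n (f : boolfun n) : nat :=
  \max_(x : cube n) #|[arg min_(S < [set: 'I_n] | is_certificate f x S) #|S| ]|.

Definition overwrite n (S : {set 'I_n}) (z x : cube n) : cube n :=
  [ffun i => if i \in S then z i else x i].

(* A restriction is kept as a function on the whole cube that ignores the
   fixed coordinates; the algorithms below record which ones are fixed. *)
Definition restrict n (f : boolfun n) (S : {set 'I_n}) (z : cube n) :
    boolfun n :=
  fun x => f (overwrite S z x).

(** ** The p-biased distribution on the cube *)

Definition bernoulli_weight (R : realType) (p : R) (b : bool) : R :=
  if b then p else 1 - p.

Definition biased_weight (R : realType) n (p : R) (x : cube n) : R :=
  \prod_i bernoulli_weight p (x i).

Definition biased_expectation (R : realType) n (p : R) (f : boolfun n) : R :=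
  \sum_x biased_weight p x * (f x)%:R.

(* Unique for a nonconstant monotone f, the only case in which it is used. *)
Definition critical_prob (R : realType) n (f : boolfun n) : R :=
  xget 0 [set p : R | 0 <= p <= 1 /\ biased_expectation p f = 2^-1].

(* Twice the probability that f x <> f x', where x is p-biased and x' is x with
   coordinate i replaced by an independent p-biased bit b. *)
Definition influence (R : realType) n (p : R) (f : boolfun n) (i : 'I_n) : R :=
  2 * \sum_(x : cube n) \sum_(b : bool)
        biased_weight p x * bernoulli_weight p b
        * (f x != f (overwrite [set i] [ffun=> b] x))%:R.

(** ** Randomized computations *)

(* A finitely supported subdistribution, as a list of weighted outcomes
   (repetitions allowed). The missing mass is that of diverging runs. *)
Definition rand (R : realType) (T : Type) := seq (R * T).

Definition prob (R : realType) T (m : rand R T) (E : T -> bool) : R :=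
  \sum_(w <- m | E w.2) w.1.

Definition is_distribution (R : realType) T (m : rand R T) : Prop :=
  all (fun w => 0 <= w.1) m /\ prob m xpredT = 1.

Definition ret (R : realType) T (t : T) : rand R T := [:: (1, t)].

Definition diverge (R : realType) T : rand R T := [::].

(* The randomness of h is drawn afresh, independently of that of m. *)
Definition bind (R : realType) T U (m : rand R T) (h : T -> rand R U) :
    rand R U :=
  [seq (w.1 * v.1, v.2) | w <- m, v <- h w.2].

(* A run that still satisfies the guard after [fuel] passes diverges. *)
Fixpoint while (R : realType) T (fuel : nat) (guard : T -> bool)
    (body : T -> rand R T) (t : T) : rand R T :=
  if guard t then
    if fuel is fuel'.+1 then bind (body t) (while fuel' guard body)
    else diverge R T
  else ret R t.

(** ** The algorithms *)

(* The two estimation procedures, the only sources of randomness. Each receives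
   the current restricted function; the second also receives a bias p. *)
Definition crit_estimator (R : realType) n := boolfun n -> rand R R.
Definition infl_estimator (R : realType) n := boolfun n -> R -> rand R ('I_n -> R).

(* An estimator always halts with some answer; on the functions met by the
   algorithms it errs by more than eps with probability at most delta. *)
Definition accurate_crit (R : realType) n (k : nat) (eps delta : R)
    (est : crit_estimator R n) : Prop :=
  (forall g : boolfun n, is_distribution (est g)) /\
  forall g : boolfun n,
    monotone g -> (cert_complexity g <= k)%N -> ~~ is_constant g ->
    1 - delta <= prob (est g) (fun p => `|p - critical_prob R g| <= eps).

Definition accurate_infl (R : realType) n (k : nat) (eps delta : R)
    (est : infl_estimator R n) : Prop :=
  (forall (g : boolfun n) (p : R), is_distribution (est g p)) /\
  forall (g : boolfun n) (p : R),
    monotone g -> (cert_complexity g <= k)%N -> ~~ is_constant g ->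
    0 <= p <= 1 ->
    1 - delta <=
      prob (est g p) (fun e => [forall i, `|e i - influence p g i| <= eps]).

Definition largest (R : realType) n (A : {set 'I_n}) (e : 'I_n -> R) :
    option 'I_n :=
  [pick i in A | [forall j in A, e j <= e i]].

(* The first algorithm, on a function g whose variables are the coordinates in
   A. The loop state is the set S0 chosen so far with the current restriction h
   of g. Only the coordinates still free, A :\: S0, compete for the largest
   influence, so n passes of fuel are never exhausted. *)
Definition algorithm1 (R : realType) n (est_crit : crit_estimator R n)
    (est_infl : infl_estimator R n) (A : {set 'I_n}) (g : boolfun n) :
    rand R {set 'I_n} :=
  bind
    (while n (fun st : {set 'I_n} * boolfun n => ~~ is_constant st.2)
      (fun st => let: (S0, h) := st in
        bind (est_crit h) (fun p =>
        bind (est_infl h p) (fun e =>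
        if largest (A :\: S0) e is Some i then
          let b := p < 2^-1 in
          ret R (i |: S0, restrict h [set i] [ffun=> b])
        else diverge R _)))
      (finset.set0, g))
    (fun st => ret R st.1).

Record state2 n := State2 {
  chosen : {set 'I_n};
  current : boolfun n;
  iterations : nat
}.

(* The second algorithm. Its output is the field [chosen] of the final state,
   and [iterations] counts the passes through its main loop. Every pass fixes
   at least one more coordinate, so n passes of fuel are never exhausted. *)
Definition algorithm2 (R : realType) n (est_crit : crit_estimator R n)
    (est_infl : infl_estimator R n) (f : boolfun n) (xstar : cube n) :
    rand R (state2 n) :=
  while n (fun st => ~~ is_constant (current st))
    (fun st =>
      bind (algorithm1 est_crit est_infl (~: chosen st) (current st)) (fun s =>
      ret R (State2 (chosen st :|: s) (restrict (current st) s xstar)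
                    (iterations st).+1)))
    (State2 finset.set0 f 0).

(* Main.v *)
(* First algorithm. Let g be nonconstant and monotone with C(g) <= k. Its
   covariance with itself is bounded along a query strategy: querying a
   coordinate costs at most half its influence, and querying a 0-certificate of
   size <= k lowers the 1-certificate complexity, so k rounds suffice. Hence
   Var g <= k^2 * (max influence) / 2, and at a bias near the critical one some
   influence is at least of order 1/k^2. Fixing that coordinate (to 0 if
   p >= 1/2) changes the p-biased mean by order 1/k^2; since p |-> E_p[g] is
   2k-Lipschitz (raising or lowering p resets random coordinates, which matters
   only if a certificate is hit), the critical probability moves away from 1/2
   by order 1/k^3. It cannot leave [0, 1], so there are O(k^3) passes.

   Second algorithm. Whatever the estimates, the first algorithm returns a set
   that some assignment turns into a certificate of a value v. It meets every
   certificate of the other value, so each pass lowers one of the two one-sided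
   certificate complexities, and there are at most 2k passes. *)
Require Import Defs.
From mathcomp Require Import all_boot all_order all_algebra.
From mathcomp Require Import reals.
From mathcomp Require Import zify ring lra.
From mathcomp Require boolp classical_sets.
Import Order.TTheory GRing.Theory Num.Theory.
Local Open Scope ring_scope.
Set Implicit Arguments.
Unset Strict Implicit.
Unset Printing Implicit Defensive.

(** * Certificates and restrictions *)

(** One-sided certificate complexity, as an upper bound for the inputs of value [v]. The two values
    are kept apart because a pass of the second algorithm is only guaranteed to lower one of the two
    bounds. *)
Definition certs n (f : boolfun n) (v : bool) (a : nat) : Prop :=
  forall x, f x = v ->
    exists2 S : {set 'I_n}, is_certificate f x S & (#|S| <= a)%N.

Lemma is_certificateP n (f : boolfun n) (x : cube n) (S : {set 'I_n}) :
  reflect (forall y : cube n, (forall i, i \in S -> y i = x i) -> f y = f x)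
          (is_certificate f x S).
Proof.
apply: (iffP forallP) => [H y yx | H y].
  by apply/eqP/(implyP (H y))/forall_inP => i iS; rewrite yx.
by apply/implyP => /forall_inP yx; apply/eqP/H => i iS; apply/eqP/yx.
Qed.

Lemma is_constantP n (f : boolfun n) :
  reflect (forall x y, f x = f y) (is_constant f).
Proof.
apply: (iffP forallP) => [H x y | H x]; first by apply/eqP/(forallP (H x)).
by apply/forallP => y; apply/eqP/H.
Qed.

Lemma nonconstantP n (f : boolfun n) v : ~~ is_constant f -> exists x, f x = v.
Proof.
move=> /forallPn[x /forallPn[y fxy]].
case: (eqVneq (f x) v) => [|fxv]; first by exists x.
by exists y; case: (f x) (f y) v fxy fxv => [] [] [].
Qed.

Lemma cert_complexity_certs n (f : boolfun n) k v :
  (cert_complexity f <= k)%N -> certs f v k.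
Proof.
move=> /bigmax_leqP Cfk x _; move: (Cfk x isT).
case: arg_minnP => [|S cS _ Sk]; last by exists S.
by apply/is_certificateP => y yx; congr f; apply/ffunP => i; apply: yx.
Qed.

Lemma certs_cert_complexity n (f : boolfun n) k :
  (forall v, certs f v k) -> (cert_complexity f <= k)%N.
Proof.
move=> Cf; apply/bigmax_leqP => x _; case: arg_minnP => [|S cS minS].
  by apply/is_certificateP => y yx; congr f; apply/ffunP => i; apply: yx.
by have [S' cS' S'k] := Cf _ x erefl; apply: leq_trans S'k; apply: minS.
Qed.

Lemma overwriteE n (S : {set 'I_n}) (z x : cube n) i :
  overwrite S z x i = if i \in S then z i else x i.
Proof. by rewrite ffunE. Qed.

Lemma certs0 n (f : boolfun n) v x : certs f v 0 -> f x = v -> is_constant f.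
Proof.
move=> Cf /Cf[S /is_certificateP cS]; rewrite leqn0 cards_eq0 => /eqP S0.
have fE y : f y = f x by apply: cS => i; rewrite S0 inE.
by apply/is_constantP => y z; rewrite !fE.
Qed.

Lemma certs_restrict n (f : boolfun n) v a s w :
  certs f v a -> certs (restrict f s w) v a.
Proof.
move=> Cf x /Cf[S /is_certificateP cS Sa]; exists S => //.
apply/is_certificateP => y yx; apply: cS => i iS; rewrite !overwriteE.
by case: ifP => // _; apply: yx.
Qed.

(* A certificate of one value meets every certificate of the other value. *)
Lemma certs_restrict_pred n (f : boolfun n) v a s z w :
    (forall x, restrict f s z x = ~~ v) ->
  certs f v a -> certs (restrict f s w) v a.-1.
Proof.
move=> fz Cf x fx; have [S /is_certificateP cS Sa] := Cf _ fx.
exists (S :\: s).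
  apply/is_certificateP => y yx; apply: cS => i iS; rewrite !overwriteE.
  by case: ifPn => // iNs; apply: yx; rewrite inE iNs.
(* If [S] missed [s], writing [z] on [s] would give a point of value [v] by the certificate and of
   value [~~ v] by [fz]. *)
have [S_s | S_s] := boolP [disjoint S & s].
  have : f (overwrite s z (overwrite s w x)) = v.
    rewrite -[RHS]fx; apply: cS => i iS; rewrite overwriteE.
    by rewrite (disjointFr S_s iS).
  by rewrite -/(restrict f s z _) fz; case: (v).
have lt0 : (0 < #|S :&: s|)%N by rewrite card_gt0 setI_eq0.
by have := cardsID s S; rewrite -subn1; lia.
Qed.

Lemma cert_complexity_restrict n (f : boolfun n) k s w :
  (cert_complexity f <= k)%N -> (cert_complexity (restrict f s w) <= k)%N.
Proof.
move=> Cf; apply: certs_cert_complexity => v.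
by apply/certs_restrict/cert_complexity_certs.
Qed.

Lemma monotone_restrict n (f : boolfun n) s w :
  monotone f -> monotone (restrict f s w).
Proof.
by move=> mf x y xy; apply: mf => i; rewrite !overwriteE; case: ifP.
Qed.

(** Restrictions remain functions on the whole cube, so this tracks the coordinates on which they
    may still depend. *)
Definition junta n (f : boolfun n) (A : {set 'I_n}) : Prop :=
  forall x y : cube n, (forall i, i \in A -> x i = y i) -> f x = f y.

Lemma junta_restrict n (f : boolfun n) A s z :
  junta f A -> junta (restrict f s z) (A :\: s).
Proof.
move=> fA x y xy; apply: fA => i iA; rewrite !overwriteE.
by case: ifPn => // is_; apply: xy; rewrite inE is_.
Qed.

Lemma junta0 n (f : boolfun n) : junta f finset.set0 -> is_constant f.
Proof.
by move=> f0; apply/is_constantP => x y; apply: f0 => i; rewrite inE.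
Qed.

Lemma restrict_restrict n (f : boolfun n) S z s w :
  restrict (restrict f S z) s w = restrict f (S :|: s) (overwrite S z w).
Proof.
apply: boolp.funext => x; rewrite /restrict; congr f; apply/ffunP => i.
by rewrite !overwriteE inE; case: (i \in S).
Qed.

Lemma restrict0 n (f : boolfun n) z : restrict f finset.set0 z = f.
Proof.
apply: boolp.funext => x; rewrite /restrict; congr f; apply/ffunP => i.
by rewrite overwriteE inE.
Qed.

(** * Biased expectations *)

Definition set_bit n (i : 'I_n) (b : bool) (x : cube n) : cube n :=
  overwrite [set i] [ffun=> b] x.

Lemma set_bitE n (i : 'I_n) b x j : set_bit i b x j = if j == i then b else x j.
Proof. by rewrite overwriteE inE ffunE. Qed.

Lemma set_bit_idem n (i : 'I_n) b c x :
  set_bit i b (set_bit i c x) = set_bit i b x.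
Proof. by apply/ffunP => j; rewrite !set_bitE; case: (j == i). Qed.

Lemma set_bit_id n (i : 'I_n) (x : cube n) : set_bit i (x i) x = x.
Proof. by apply/ffunP => j; rewrite set_bitE; case: eqP => [->|]. Qed.

Definition expect (R : realType) n (p : R) (F : cube n -> R) : R :=
  \sum_x biased_weight p x * F x.

Section Expectation.
Context {R : realType} {n : nat}.
Implicit Types (p q r : R) (F G : cube n -> R) (f g h : boolfun n).
Implicit Types (i : 'I_n) (x y z : cube n).

Lemma biased_expectationE p f :
  biased_expectation p f = expect p (fun x => (f x)%:R).
Proof. by []. Qed.

Lemma bernoulli_weight_ge0 p b : 0 <= p <= 1 -> 0 <= bernoulli_weight p b.
Proof. by case: b => /andP[] //=; rewrite subr_ge0. Qed.

Lemma sum_bernoulli_weight p : \sum_b bernoulli_weight p b = 1.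
Proof. by rewrite big_bool /= addrC subrK. Qed.

Lemma biased_weight_ge0 p x : 0 <= p <= 1 -> 0 <= biased_weight p x.
Proof. by move=> p01; apply: prodr_ge0 => i _; apply: bernoulli_weight_ge0. Qed.

Lemma eq_expect p F G : F =1 G -> expect p F = expect p G.
Proof. by move=> FG; apply: eq_bigr => x _; rewrite FG. Qed.

Lemma le_expect p F G :
  0 <= p <= 1 -> (forall x, F x <= G x) -> expect p F <= expect p G.
Proof.
by move=> p01 FG; apply: ler_sum => x _; rewrite ler_wpM2l ?biased_weight_ge0.
Qed.

Lemma expectZ p a F : expect p (fun x => a * F x) = a * expect p F.
Proof. by rewrite big_distrr; apply: eq_bigr => x _; rewrite mulrCA. Qed.

Lemma expectB p F G : expect p (fun x => F x - G x) = expect p F - expect p G.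
Proof. by rewrite -sumrB; apply: eq_bigr => x _; rewrite mulrBr. Qed.

Lemma expect_sum (I : finType) (P : pred I) p (F : I -> cube n -> R) :
  expect p (fun x => \sum_(i | P i) F i x) = \sum_(i | P i) expect p (F i).
Proof.
by rewrite exchange_big; apply: eq_bigr => x _; rewrite big_distrr.
Qed.

Lemma ler_norm_expect p F :
  0 <= p <= 1 -> `|expect p F| <= expect p (fun x => `|F x|).
Proof.
move=> p01; apply: (le_trans (ler_norm_sum _ _ _)); apply: ler_sum => x _.
by rewrite normrM (ger0_norm (biased_weight_ge0 x p01)).
Qed.

(** By distributivity the total weight is a product of factors [p + (1 - p)], for every real [p]. *)
Lemma expect_cst p a : expect p (fun _ : cube n => a) = a.
Proof.
rewrite /expect -big_distrl /= -[RHS]mul1r; congr (_ * _).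
rewrite -(bigA_distr_bigA (fun _ => bernoulli_weight p)).
by rewrite big1 // => i _; rewrite sum_bernoulli_weight.
Qed.

(** Conditioning on bit [i]: the weight of the other coordinates is the same on both faces of the
    cube. *)
Lemma expect_set_bit p i F :
  expect p F = \sum_b bernoulli_weight p b * expect p (F \o set_bit i b).
Proof.
(* [w] is the weight of the coordinates other than [i], and [H b] the unnormalised sum over the face
   [x i = b]. *)
pose w (x : cube n) := \prod_(j | j != i) bernoulli_weight p (x j).
pose H b := \sum_(x : cube n | x i == b) w x * F x.
have wE x : biased_weight p x = bernoulli_weight p (x i) * w x.
  by rewrite /biased_weight (bigD1 i).
(* [set_bit i b] maps the face [x i = c] bijectively onto the face [x i = b] and preserves [w]. *)
have HE c b : \sum_(x : cube n | x i == c) w x * F (set_bit i b x) = H b.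
  rewrite /H [RHS](reindex_onto (set_bit i b) (set_bit i c)); last first.
    by move=> x /eqP <-; rewrite set_bit_idem set_bit_id.
  apply: eq_big => [x | x _]; last first.
    congr (_ * _); apply: eq_bigr => j /negPf ji.
    by rewrite set_bitE ji.
  rewrite set_bitE !eqxx /= set_bit_idem; apply/eqP/eqP => [<-|<-].
    exact: set_bit_id.
  by rewrite set_bitE eqxx.
have -> : expect p F = \sum_b bernoulli_weight p b * H b.
  rewrite /expect (partition_big (fun x : cube n => x i) xpredT) //=.
  apply: eq_bigr => b _; rewrite big_distrr; apply: eq_bigr => x /eqP <-.
  by rewrite wE /= mulrA.
apply: eq_bigr => b _; congr (_ * _).
rewrite /expect (partition_big (fun x : cube n => x i) xpredT) //=.
rewrite -[LHS]mul1r -(sum_bernoulli_weight p) big_distrl.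
apply: eq_bigr => c _; rewrite -(HE c) big_distrr; apply: eq_bigr => x /eqP <-.
by rewrite wE /= mulrA.
Qed.

Lemma influenceE p f i :
  influence p f i =
  2 * \sum_b bernoulli_weight p b
             * expect p (fun x => (f x != f (set_bit i b x))%:R).
Proof.
rewrite /influence exchange_big; congr (_ * _); apply: eq_bigr => b _.
by rewrite /expect big_distrr; apply: eq_bigr => x _ /=; rewrite mulrCA !mulrA.
Qed.

(** A new bit [b] changes [f] only if the old bit was [~~ b] and the two faces disagree; by
    monotonicity the indicator of disagreement is a difference of values. Both choices of [b]
    contribute [p * (1 - p)], whence the factor 4. *)
Lemma influence_monotone p f i : monotone f ->
  influence p f i =
  4 * p * (1 - p) * (expect p (fun x => (f (set_bit i true x))%:R)
                     - expect p (fun x => (f (set_bit i false x))%:R)).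
Proof.
move=> mf; rewrite influenceE -expectB.
set D := expect p _.
have flipE b : expect p (fun x => (f x != f (set_bit i b x))%:R)
               = bernoulli_weight p (~~ b) * D.
  rewrite (expect_set_bit _ i) (bigD1 (~~ b)) //= [X in _ + X]big1 => [|c].
    rewrite addr0; congr (_ * _); apply: eq_expect => x /=.
    rewrite set_bit_idem.
    have : (f (set_bit i false x) <= f (set_bit i true x))%N.
      by apply: mf => j; rewrite !set_bitE; case: ifP.
    case: b => /=; case: (f (set_bit i true x)); case: (f (set_bit i false x));
      by rewrite //= ?subrr ?subr0.
  move=> cb; have -> : c = b by case: b c cb => [] [].
  under eq_expect => x do rewrite /= set_bit_idem eqxx.
  by rewrite expect_cst mulr0.
by rewrite big_bool !flipE /=; ring.
Qed.

(** * Covariance along a query strategy *)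

Definition covariance p f g : R :=
  expect p (fun x => (f x)%:R * (g x)%:R)
  - biased_expectation p f * biased_expectation p g.

(* Conditioning on a queried bit changes the covariance with g by at most half
   the influence of that bit on g. *)
Lemma cov_restrict (M B : R) p f g (s : {set 'I_n}) :
    0 <= p <= 1 -> (forall i, influence p g i <= 2 * M) ->
    (forall z, `|covariance p (restrict f s z) g| <= B) ->
  `|covariance p f g| <= #|s|%:R * M + B.
Proof.
rewrite /covariance !biased_expectationE => p01 gM.
(* Induction on the size of [s]: one coordinate of [s] is queried at a time, while [g] is never
   restricted. *)
have [m] := ubnP #|s|; elim: m => // m IH in s f *.
rewrite ltnS => sm fB.
have [s0 | [i is_]] := set_0Vmem s.
  rewrite s0 cards0 mul0r add0r; have := fB [ffun=> false].
  suff -> : restrict f s [ffun=> false] = f by [].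
  apply: boolp.funext => x; rewrite /restrict; congr f.
  by apply/ffunP => j; rewrite overwriteE s0 inE.
have cs : #|s| = #|s :\ i|.+1 by rewrite (cardsD1 i s) is_.
set Eg := expect p (fun x => (g x)%:R).
pose fb b x : R := (f (set_bit i b x))%:R.
pose fg b := expect p (fun x => fb b x * (g (set_bit i b x))%:R).
have IHb b : `|expect p (fun x => fb b x * (g x)%:R) - expect p (fb b) * Eg|
             <= #|s :\ i|%:R * M + B.
  apply: (IH (s :\ i) (fun x => f (set_bit i b x))) => [|z].
    by rewrite -ltnS -cs ltnS.
  have := fB (set_bit i b z).
  suff -> : restrict f s (set_bit i b z)
            = restrict (fun x => f (set_bit i b x)) (s :\ i) z by [].
  apply: boolp.funext => x; rewrite /restrict; congr f; apply/ffunP => j.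
  by rewrite !overwriteE !inE !ffunE; case: eqP => // ->; rewrite is_.
pose dif b := expect p (fun x => (g x != g (set_bit i b x))%:R).
(* Replacing [g] on the face [b] by [g] itself costs the probability that writing [b] changes [g];
   averaged over [b] this is half the influence. *)
have Db b : `|fg b - expect p (fun x => fb b x * (g x)%:R)| <= dif b.
  rewrite -expectB; apply: (le_trans (ler_norm_expect _ p01)).
  apply: le_expect => // x; rewrite /fb.
  by case: (f _) (g x) (g (set_bit i b x)) => [] [] [];
     rewrite ?mul1r ?mul0r ?mulr1 ?mulr0 ?subrr ?subr0 ?sub0r ?normrN
             ?normr1 ?normr0 //=.
have E1 : expect p (fun x => (f x)%:R * (g x)%:R)
        = \sum_b bernoulli_weight p b * fg b.
  exact: expect_set_bit.
have E2 : expect p (fun x => (f x)%:R)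
        = \sum_b bernoulli_weight p b * expect p (fb b).
  exact: expect_set_bit.
have dM : \sum_b bernoulli_weight p b * dif b <= M.
  by have := gM i; rewrite influenceE ler_pM2l.
rewrite E1 E2 big_distrl -sumrB.
rewrite (eq_bigr (fun b => bernoulli_weight p b *
    (fg b - expect p (fb b) * Eg)));
  last by move=> b _; rewrite mulrBr mulrA.
apply: (le_trans (ler_norm_sum _ _ _)).
have bnd b : `|bernoulli_weight p b *
    (fg b - expect p (fb b) * Eg)| <=
    bernoulli_weight p b * dif b + bernoulli_weight p b * (#|s :\ i|%:R * M + B).
  rewrite normrM ger0_norm ?bernoulli_weight_ge0 // -mulrDr.
  rewrite ler_wpM2l ?bernoulli_weight_ge0 //.
  apply: le_trans (lerD (Db b) (IHb b)).
  by apply: le_trans (ler_normD _ _); rewrite addrA subrK.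
apply: (le_trans (ler_sum _ (fun b _ => bnd b))).
rewrite big_split /= -big_distrl /= sum_bernoulli_weight mul1r cs -natr1.
by rewrite mulrDl mul1r [X in _ <= X + _]addrC -addrA lerD2r.
Qed.

End Expectation.

(** A coupling of two biases: the mask [z] keeps some coordinates of [x] and sets the others to
    [c]. *)
Definition reset n (c : bool) (z x : cube n) : cube n :=
  [ffun i => if z i then x i else c].

Section Analysis.
Context {R : realType} {n : nat}.
Implicit Types (p q r : R) (F G : cube n -> R) (f g h : boolfun n).
Implicit Types (i : 'I_n) (x y z : cube n).

(** Induction on [a]: querying a 0-certificate costs at most [k * M] and lowers the bound on
    1-certificates by one; a constant function has covariance 0. *)
Lemma cov_certs (M : R) p f g k a :
    0 <= p <= 1 -> 0 <= M -> (forall i, influence p g i <= 2 * M) ->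
    certs f false k -> certs f true a ->
  `|covariance p f g| <= (a * k)%:R * M.
Proof.
move=> p01 M0 gM.
have base h b : is_constant h ->
  `|covariance p h g| <= b%:R * M.
  rewrite /covariance !biased_expectationE => /is_constantP hc.
  have -> : h = fun=> h [ffun=> false] by apply: boolp.funext => x; apply: hc.
  by rewrite expect_cst expectZ subrr normr0 mulr_ge0.
elim: a f => [|a IH] f Cf0 Cf1.
  apply: base; have [//|nf] := boolP (is_constant f).
  by have [y fy] := nonconstantP true nf; rewrite (certs0 Cf1 fy) in nf.
have [/base-> // | nf] := boolP (is_constant f).
have [x fx] := nonconstantP false nf.
(* The values of [x] on [S] force [f] to be false, so every 1-certificate meets [S], whatever
   answers [z] the queries receive. *)
have [S /is_certificateP cS Sk] := Cf0 _ fx.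
apply: (@le_trans _ _ (#|S|%:R * M + (a * k)%:R * M)).
  apply: cov_restrict => // z; apply: IH; first exact: certs_restrict.
  apply: (certs_restrict_pred (z := x) _ Cf1) => y; apply: etrans fx.
  by apply: cS => i iS; rewrite overwriteE iS.
by rewrite mulSn natrD mulrDl lerD2r ler_wpM2r // ler_nat.
Qed.

(** The covariance bound with [f = g] and [a = k]; as [g] is Boolean, its square is [g] and the
    covariance is the variance. *)
Lemma variance_le_influence (M : R) p g k :
    0 <= p <= 1 -> 0 <= M -> (forall i, influence p g i <= 2 * M) ->
    (cert_complexity g <= k)%N ->
  biased_expectation p g * (1 - biased_expectation p g) <= k%:R ^+ 2 * M.
Proof.
move=> p01 M0 gM Cg.
have Cv v := cert_complexity_certs (v := v) Cg.
have := cov_certs p01 M0 gM (Cv false) (Cv true); rewrite /covariance.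
rewrite (eq_expect _ (G := fun x => (g x)%:R)) => [|x]; last first.
  by case: (g x); rewrite ?mulr1 ?mulr0.
rewrite -biased_expectationE natrM -expr2 => /(le_trans (ler_norm _)).
by rewrite mulrBr mulr1.
Qed.

(** A bit of the reset point is [~~ c] exactly when it was so before and the mask kept it. The
    hypothesis says that this turns bias [p] into bias [q]. *)
Lemma expect_reset p q r c F :
    bernoulli_weight q (~~ c) = r * bernoulli_weight p (~~ c) ->
  expect q F = expect p (fun x => expect r (fun z => F (reset c z x))).
Proof.
move=> qrp.
have mass b : bernoulli_weight q b =
    \sum_a bernoulli_weight p a *
    \sum_d bernoulli_weight r d * ((if d then a else c) == b)%:R.
  by move: qrp; rewrite !big_bool; case: c b => [] [] /=; lra.
have pushforward y : biased_weight q y =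
    \sum_x biased_weight p x * \sum_z biased_weight r z * (reset c z x == y)%:R.
  rewrite /biased_weight.
  under eq_bigr do rewrite mass.
  rewrite bigA_distr_bigA; apply: eq_bigr => x _.
  rewrite big_split /= bigA_distr_bigA; congr (_ * _); apply: eq_bigr => z _.
  rewrite big_split /=; congr (_ * _).
  (* The product of the coordinatewise indicators is the indicator of equality of the two points. *)
  have [<-|xy] := eqVneq (reset c z x) y.
    by rewrite big1 // => i _; rewrite ffunE eqxx.
  have /forallPn[i iE] : ~~ [forall i, reset c z x i == y i].
    by apply: contra xy => /forallP xy; apply/eqP/ffunP => i; apply/eqP.
  by rewrite (bigD1 i) //= -(ffunE (fun i => if z i then x i else c)) (negPf iE)
             mul0r.
rewrite /expect.
under eq_bigr do rewrite pushforward big_distrl.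
rewrite exchange_big; apply: eq_bigr => x _ /=.
under eq_bigr do rewrite -mulrA big_distrl.
rewrite -big_distrr exchange_big; congr (_ * _); apply: eq_bigr => z _ /=.
under eq_bigr do rewrite -mulrA.
rewrite -big_distrr /=; congr (_ * _).
rewrite (bigD1 (reset c z x)) //= eqxx mul1r big1 ?addr0 // => y.
by rewrite eq_sym => /negPf ->; rewrite mul0r.
Qed.

(** Keeping each bit with probability [p / q] and setting it to 0 otherwise turns bias [q] into bias
    [p], and it can only decrease [f]. The quotient requires the case [q = 0] apart. *)
Lemma biased_expectation_monotone p q f :
  0 <= p <= q -> q <= 1 -> monotone f ->
  biased_expectation p f <= biased_expectation q f.
Proof.
move=> /andP[p0 pq] q1 mf; rewrite !biased_expectationE.
have [q0 | q0] := eqVneq q 0.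
  by rewrite (_ : p = q) //; apply/le_anti; rewrite pq q0 p0.
have qgt0 : 0 < q by rewrite lt_neqAle eq_sym q0 (le_trans p0).
rewrite (@expect_reset q p (p / q) false) /= ?divfK //.
apply: le_expect => [|x]; first by rewrite ltW.
rewrite -[leRHS](expect_cst (n := n) (p / q)); apply: le_expect => [|z].
  by rewrite divr_ge0 ?(ltW qgt0) //= ler_pdivrMr // mul1r.
rewrite ler_nat; apply: mf => i; rewrite ffunE; by case: (z i).
Qed.

(* Resetting changes f only if it hits a certificate of the original point. *)
Lemma reset_lipschitz p q r c f k :
    0 <= p <= 1 -> 0 <= r <= 1 -> (cert_complexity f <= k)%N ->
    bernoulli_weight q (~~ c) = r * bernoulli_weight p (~~ c) ->
  `|biased_expectation q f - biased_expectation p f| <= k%:R * (1 - r).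
Proof.
move=> p01 r01 Cf qrp; rewrite !biased_expectationE (expect_reset _ qrp).
rewrite -expectB; apply: (le_trans (ler_norm_expect _ p01)).
rewrite -[leRHS](expect_cst (n := n) p); apply: le_expect => // x.
have [S /is_certificateP cS Sk] := cert_complexity_certs Cf (erefl (f x)).
rewrite -[X in _ - X](expect_cst (n := n) r) -expectB.
apply: (le_trans (ler_norm_expect _ r01)).
have bit i : expect r (fun z => (~~ z i)%:R) = 1 - r :> R.
  rewrite (expect_set_bit _ i) big_bool /=.
  rewrite (eq_expect _ (G := fun=> 0)) => [|z]; last by rewrite /= set_bitE eqxx.
  rewrite [X in _ + _ * X](eq_expect _ (G := fun=> 1)) => [|z]; last first.
    by rewrite /= set_bitE eqxx.
  by rewrite !expect_cst mulr0 mulr1 add0r.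
(* Union bound over the certificate: each of its coordinates is reset with probability [1 - r]. *)
apply: (@le_trans _ _ (\sum_(i in S) expect r (fun z => (~~ z i)%:R))).
  rewrite -expect_sum; apply: le_expect => // z.
  have [/forall_inP zS | /forall_inPn[i iS zi]] := boolP [forall i in S, z i].
    rewrite (cS (reset c z x)) => [|i iS]; last by rewrite ffunE zS.
    by rewrite subrr normr0 sumr_ge0.
  rewrite (bigD1 i) //= zi.
  apply: (@le_trans _ _ 1); last by rewrite lerDl sumr_ge0.
  by case: (f _) (f _) => [] [];
    rewrite ?subrr ?subr0 ?sub0r ?normrN ?normr1 ?normr0.
under eq_bigr do rewrite bit.
rewrite sumr_const -[_ *+ #|_|]mulr_natl ler_wpM2r ?ler_nat //.
by case/andP: r01 => _; rewrite subr_ge0.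
Qed.

(** For [p <= q], lower [q] to [p] if [q >= 1/2], and raise [p] to [q] otherwise. The reset
    probability is then [q - p] divided by [q] or by [1 - p], which is at least 1/2; this gives the
    factor 2. *)
Lemma biased_expectation_lipschitz p q f k :
    0 <= p <= 1 -> 0 <= q <= 1 -> (cert_complexity f <= k)%N ->
  `|biased_expectation p f - biased_expectation q f| <= 2 * k%:R * `|p - q|.
Proof.
move=> p01 q01 Cf.
wlog pq : p q p01 q01 / p <= q => [H|].
  case/orP: (le_total p q) => [/H|/H]; first exact.
  by move=> qp; rewrite distrC [`|p - q|]distrC; apply: qp.
have /andP[p0 p1] := p01; have /andP[q0 q1] := q01.
rewrite [`|p - q|]distrC (ger0_norm (x := q - p)) ?subr_ge0 //.
have [qh | qh] := leP 2^-1 q.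
  have qgt0 : 0 < q by apply: lt_le_trans qh; rewrite invr_gt0.
  have r01 : 0 <= p / q <= 1.
    by rewrite divr_ge0 //= ler_pdivrMr // mul1r.
  have rqp := esym (divfK (lt0r_neq0 qgt0) p).
  apply: (le_trans (reset_lipschitz (q := p) (c := false) q01 r01 Cf rqp)).
  rewrite [2 * _]mulrC -mulrA ler_wpM2l //.
  have -> : 1 - p / q = (q - p) / q by rewrite mulrBl divff ?lt0r_neq0.
  rewrite ler_pdivrMr // mulrC; nra.
have pgt0 : 0 < 1 - p by lra.
have r01 : 0 <= (1 - q) / (1 - p) <= 1.
  by rewrite divr_ge0 ?subr_ge0 //= ler_pdivrMr // mul1r lerD2l lerN2.
have rpq := esym (divfK (lt0r_neq0 pgt0) (1 - q)).
rewrite distrC; apply: (le_trans (reset_lipschitz (c := true) p01 r01 Cf rpq)).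
rewrite [2 * _]mulrC -mulrA ler_wpM2l //.
have -> : 1 - (1 - q) / (1 - p) = (q - p) / (1 - p).
  by field; rewrite lt0r_neq0.
rewrite ler_pdivrMr //; nra.
Qed.

(** * The critical probability *)

Lemma biased_expectation0 f :
  biased_expectation (0 : R) f = (f [ffun=> false])%:R.
Proof.
rewrite /biased_expectation (bigD1 [ffun=> false]) //= big1 => [|x xN0].
  by rewrite addr0 /biased_weight big1 ?mul1r // => i _; rewrite ffunE /= subr0.
have [i xi] : exists i, x i.
  apply/existsP; apply: contraNT xN0 => /existsPn x0.
  by apply/eqP/ffunP => i; rewrite ffunE (negPf (x0 i)).
by rewrite /biased_weight (bigD1 i) //= xi !mul0r.
Qed.

Lemma biased_expectation1 f :
  biased_expectation (1 : R) f = (f [ffun=> true])%:R.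
Proof.
rewrite /biased_expectation (bigD1 [ffun=> true]) //= big1 => [|x xN1].
  by rewrite addr0 /biased_weight big1 ?mul1r // => i _; rewrite ffunE.
have [i xi] : exists i, ~~ x i.
  apply/existsP; apply: contraNT xN1 => /existsPn x1.
  by apply/eqP/ffunP => i; rewrite ffunE; apply/negPn/x1.
by rewrite /biased_weight (bigD1 i) //= (negPf xi) /= subrr !mul0r.
Qed.

Lemma nonconstant_monotone f : monotone f -> ~~ is_constant f ->
  f [ffun=> false] = false /\ f [ffun=> true] = true.
Proof.
move=> mf nf; split.
  have [x fx] := nonconstantP false nf.
  have /mf : forall i, ([ffun=> false] i <= x i)%N by move=> i; rewrite ffunE.
  by rewrite fx; case: (f _).
have [x fx] := nonconstantP true nf.
have /mf : forall i, (x i <= [ffun=> true] i)%N.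
  by move=> i; rewrite ffunE; case: (x i).
by rewrite fx; case: (f _).
Qed.

(** The mean is a polynomial in the bias, equal to 0 at 0 and to 1 at 1, so the intermediate value
    theorem provides a point that [xget] can return. *)
Lemma critical_probP f : monotone f -> ~~ is_constant f ->
  0 <= critical_prob R f <= 1 /\
  biased_expectation (critical_prob R f) f = 2^-1.
Proof.
move=> mf nf.
suff : exists p : R, 0 <= p <= 1 /\ biased_expectation p f = 2^-1.
  exact: (@classical_sets.xgetPex _ 0 (fun p => 0 <= p <= 1 /\ _ = _)).
have [f0 f1] := nonconstant_monotone mf nf.
pose P : {poly R} :=
  \sum_(x : cube n) (\prod_i (if x i then 'X else 1 - 'X)) * (f x)%:R%:P
  - (2^-1)%:P.
have PE p : P.[p] = biased_expectation p f - 2^-1.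
  rewrite /P hornerD hornerN hornerC horner_sum; congr (_ - _).
  apply: eq_bigr => x _; rewrite hornerM hornerC horner_prod; congr (_ * _).
  by apply: eq_bigr => i _; case: (x i); rewrite /= ?hornerE.
have [|p p01 /eqP] := @poly_ivt R P 0 1 ler01.
  by rewrite !PE biased_expectation0 biased_expectation1 f0 f1 /=; lra.
rewrite PE => /eqP; rewrite subr_eq0 => /eqP Ep; exists p; split => //.
Qed.

End Analysis.

(** * One pass of the first algorithm *)

Section Step.
Context {R : realType} {n : nat}.
Implicit Types (p q : R) (f g h : boolfun n) (i : 'I_n) (A : {set 'I_n}).

(** The Lipschitz bound between the critical bias and each endpoint, where the mean differs by 1/2.
    It keeps an accurate estimate inside [0, 1]. *)
Lemma critical_prob_gap f k : monotone f -> ~~ is_constant f ->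
    (cert_complexity f <= k)%N ->
  1 <= 4 * k%:R * critical_prob R f /\ 1 <= 4 * k%:R * (1 - critical_prob R f).
Proof.
move=> mf nf Cf; have [f0 f1] := nonconstant_monotone mf nf.
have [p01 Ep] := critical_probP (R := R) mf nf.
have I0 : 0 <= (0 : R) <= 1 by rewrite lexx ler01.
have I1 : 0 <= (1 : R) <= 1 by rewrite lexx ler01.
have := biased_expectation_lipschitz p01 I0 Cf.
have := biased_expectation_lipschitz I1 p01 Cf.
rewrite Ep biased_expectation0 biased_expectation1 f0 f1 /= !subr0.
have /andP[p0 p1] := p01.
rewrite (ger0_norm p0) (ger0_norm (x := 1 - 2^-1)); last lra.
by rewrite !ger0_norm ?invr_ge0 ?subr_ge0 //; lra.
Qed.

Lemma influence_ge0 p f i : 0 <= p <= 1 -> 0 <= influence p f i.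
Proof.
move=> p01; rewrite influenceE mulr_ge0 // sumr_ge0 // => b _.
rewrite mulr_ge0 ?bernoulli_weight_ge0 // sumr_ge0 // => x _.
by rewrite mulr_ge0 ?biased_weight_ge0.
Qed.

Lemma influence_eq0 p f i :
  (forall b x, f (set_bit i b x) = f x) -> influence p f i = 0.
Proof.
move=> fi; rewrite influenceE big1 ?mulr0 // => b _.
rewrite (eq_expect _ (G := fun=> 0)) ?expect_cst ?mulr0 // => x.
by rewrite fi eqxx.
Qed.

(** With [t = 1/k], the Lipschitz bound turns the error [t^3 / 64] in the bias into [t^2 / 32] in
    the mean, which leaves a variance of at least 3/16. So some influence is at least [3/8 * t^2],
    and choosing by estimates loses [t^2 / 32]. *)
Lemma estimated_influence_ge f k A p (e : 'I_n -> R) i :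
    monotone f -> ~~ is_constant f -> (cert_complexity f <= k)%N -> (0 < k)%N ->
    0 <= p <= 1 -> `|p - critical_prob R f| <= 64^-1 / k%:R ^+ 3 ->
    (forall j, `|e j - influence p f j| <= 64^-1 / k%:R ^+ 2) ->
    i \in A -> (forall j, j \in A -> e j <= e i) ->
    junta f A ->
  `|biased_expectation p f - 2^-1| <= k%:R ^- 2 / 32 /\
  11 / 32 * k%:R ^- 2 <= influence p f i.
Proof.
move=> mf nf Cf k0 p01 pP eP iA emax fA.
have [c01 Ec] := critical_probP (R := R) mf nf.
set q := biased_expectation p f.
have k1 : 1 <= k%:R :> R by rewrite ler1n.
have kN0 : k%:R != 0 :> R by rewrite pnatr_eq0 -lt0n.
pose t : R := k%:R^-1.
have kt : k%:R * t = 1 by rewrite divff.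
have t0 : 0 < t by rewrite invr_gt0 ltr0n.
have t1 : t <= 1 by rewrite invf_le1 // ltr0n.
rewrite -!exprVn -/t in pP eP *.
have qP : `|q - 2^-1| <= t ^+ 2 / 32.
  rewrite -Ec; apply: (le_trans (biased_expectation_lipschitz p01 c01 Cf)).
  apply: (@le_trans _ _ (2 * k%:R * (64^-1 * t ^+ 3))).
    by rewrite ler_wpM2l // mulr_ge0.
  suff -> : 2 * k%:R * (64^-1 * t ^+ 3) = (k%:R * t) * (t ^+ 2 / 32).
    by rewrite kt mul1r.
  by field.
split=> //.
have I0 j := influence_ge0 f j p01.
(* Both estimates may err by [t^2 / 64], so no influence on [A] exceeds that of [i] by more than
   [t^2 / 32]. *)
pose M := (influence p f i + t ^+ 2 / 32) / 2.
have t20 : 0 <= t ^+ 2 by rewrite exprn_ge0 // ltW.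
have M0 : 0 <= M by have := I0 i; rewrite /M; lra.
have IM j : influence p f j <= 2 * M.
  have [jA | jA] := boolP (j \in A).
    have := emax _ jA; have := eP i; have := eP j.
    rewrite !ler_norml /M => /andP[? ?] /andP[? ?] ?; lra.
  (* Coordinates outside [A] do not compete, but [f] ignores them. *)
  rewrite influence_eq0 => [|b x]; first exact: mulr_ge0.
  apply: fA => l lA.
  by rewrite set_bitE; case: eqP => // lj; rewrite -lj lA in jA.
have var := variance_le_influence p01 M0 IM Cf; rewrite -/q in var.
have t2le : t ^+ 2 <= 1 by rewrite exprn_ile1 // ltW.
have var2 : 3 / 16 <= q * (1 - q).
  have : `|q - 2^-1| <= 1 / 32 by apply: (le_trans qP); lra.
  rewrite ler_norml => /andP[? ?]; nra.
have : 3 / 16 * t ^+ 2 <= M.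
  have -> : M = (k%:R ^+ 2 * M) * t ^+ 2.
    by rewrite mulrAC -exprMn kt expr1n mul1r.
  by rewrite ler_wpM2r //; apply: le_trans var.
rewrite /M; lra.
Qed.

(** Fixing [i] moves the mean at bias [p] to at least [9/64 * t^2] beyond 1/2. Monotonicity in the
    bias gives the direction in which the critical probability lies, and the Lipschitz bound its
    distance [9/128 * t^3] from [p], which exceeds three times the estimation error. *)
Lemma critical_prob_step f k A p (e : 'I_n -> R) i :
    monotone f -> ~~ is_constant f -> (cert_complexity f <= k)%N -> (0 < k)%N ->
    0 <= p <= 1 -> `|p - critical_prob R f| <= 64^-1 / k%:R ^+ 3 ->
    (forall j, `|e j - influence p f j| <= 64^-1 / k%:R ^+ 2) ->
    i \in A -> (forall j, j \in A -> e j <= e i) ->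
    junta f A ->
  let f' := restrict f [set i] [ffun=> p < 2^-1] in
  ~~ is_constant f' ->
  if p < 2^-1 then critical_prob R f' <= p - 3 * (64^-1 / k%:R ^+ 3)
  else p + 3 * (64^-1 / k%:R ^+ 3) <= critical_prob R f'.
Proof.
move=> mf nf Cf k0 p01 pP eP iA emax fA f' nf'.
have [qP infP] := estimated_influence_ge mf nf Cf k0 p01 pP eP iA emax fA.
have mf' : monotone f' by apply: monotone_restrict.
have Cf' : (cert_complexity f' <= k)%N by apply: cert_complexity_restrict.
have [c01 Ec] := critical_probP (R := R) mf' nf'.
have := biased_expectation_lipschitz p01 c01 Cf'; rewrite Ec.
set c := critical_prob R f' in c01 Ec *.
set q := biased_expectation p f in qP.
have qE : q = p * expect p (fun x => (f (set_bit i true x))%:R)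
            + (1 - p) * expect p (fun x => (f (set_bit i false x))%:R).
  by rewrite /q biased_expectationE (expect_set_bit _ i) big_bool.
have infE := influence_monotone p i mf.
have f'E : biased_expectation p f'
         = expect p (fun x => (f (set_bit i (p < 2^-1) x))%:R).
  by [].
set E1 := expect p (fun x => (f (set_bit i true x))%:R) in qE infE.
set E0 := expect p (fun x => (f (set_bit i false x))%:R) in qE infE.
have E10 : E0 <= E1.
  apply: le_expect => // x; rewrite ler_nat; apply: mf => j.
  by rewrite !set_bitE; case: ifP.
have k1 : 1 <= k%:R :> R by rewrite ler1n.
have kN0 : k%:R != 0 :> R by rewrite pnatr_eq0 -lt0n.
pose t : R := k%:R^-1.
have kt : k%:R * t = 1 by rewrite divff.
have t0 : 0 < t by rewrite invr_gt0 ltr0n.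
rewrite -!exprVn -/t in infP qP *.
have t20 : 0 < t ^+ 2 by rewrite exprn_gt0.
have {pP eP emax} := qP; rewrite ler_norml => /andP[q1 q2] lip.
have /andP[p0 p1] := p01; have /andP[c0 c1] := c01.
have t3E : t ^+ 3 = t * t ^+ 2 by rewrite exprS.
have move_ge : 9 / 64 * t ^+ 2 <= `|biased_expectation p f' - 2^-1| ->
    9 / 128 * t ^+ 3 <= `|p - c|.
  move=> /le_trans/(_ lip) H.
  rewrite (_ : `|p - c| = (2 * k%:R * `|p - c|) * (t / 2)).
    rewrite (_ : 9 / 128 * t ^+ 3 = 9 / 64 * t ^+ 2 * (t / 2)); last by field.
    by rewrite ler_wpM2r // divr_ge0 // ltW.
  rewrite (_ : _ * (t / 2) = (k%:R * t) * `|p - c|); last by field.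
  by rewrite kt mul1r.
have t30 : 0 < t ^+ 3 by rewrite exprn_gt0.
case: ltP f'E => ph f'E.
  have f'ge : 2^-1 + 9 / 64 * t ^+ 2 <= biased_expectation p f'.
    rewrite f'E -/E1; have : (1 - p) * (E1 - E0) >= 11 / 64 * t ^+ 2.
      (* Since [2 * p < 1], the influence [4 * p * (1 - p) * (E1 - E0)] is at most
         [2 * (1 - p) * (E1 - E0)]. *)
      have D0 : 0 <= (1 - p) * (E1 - E0) by rewrite mulr_ge0 ?subr_ge0.
      have p2 : 0 <= 1 - 2 * p by lra.
      by have := mulr_ge0 p2 D0; move: infP; rewrite infE; lra.
    have : E1 = q + (1 - p) * (E1 - E0) by rewrite qE; ring.
    lra.
  have cp : c <= p.
    rewrite leNgt; apply/negP => pc.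
    have : biased_expectation p f' <= biased_expectation c f'.
      by apply: biased_expectation_monotone => //; rewrite p0 ltW.
    by rewrite Ec; lra.
  have := move_ge; rewrite (ger0_norm (x := p - c)) ?subr_ge0 //.
  rewrite ger0_norm; last lra.
  by move=> H; have := H _; lra.
have f'le : biased_expectation p f' <= 2^-1 - 9 / 64 * t ^+ 2.
  rewrite f'E -/E0; have : p * (E1 - E0) >= 11 / 64 * t ^+ 2.
    have D0 : 0 <= p * (E1 - E0) by rewrite mulr_ge0 ?subr_ge0.
    have p2 : 0 <= 2 * p - 1 by lra.
    by have := mulr_ge0 p2 D0; move: infP; rewrite infE; lra.
  have : E0 = q - p * (E1 - E0) by rewrite qE; ring.
  lra.
have pc : p <= c.
  rewrite leNgt; apply/negP => cp.
  have : biased_expectation c f' <= biased_expectation p f'.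
    by apply: biased_expectation_monotone => //; rewrite c0 ltW.
  by rewrite Ec; lra.
have := move_ge; rewrite distrC (ger0_norm (x := 2^-1 - _)); last lra.
rewrite distrC (ger0_norm (x := c - p)) ?subr_ge0 //.
by move=> H; have := H _; lra.
Qed.

End Step.

(** * Randomized loops *)

(** Total mass 1 is included, so this also states that no run diverges. *)
Definition surely (R : realType) T (m : rand R T) (P : T -> Prop) : Prop :=
  all (fun w => (0 <= w.1) && boolp.asbool (P w.2)) m /\ prob m xpredT = 1.

Section Randomized.
Context {R : realType}.

Lemma probE T (m : rand R T) E : prob m E = \sum_(w <- m) w.1 * (E w.2)%:R.
Proof.
rewrite /prob big_mkcond; apply: eq_bigr => w _.
by case: (E w.2); rewrite ?mulr1 ?mulr0.
Qed.

Lemma prob_bind T U (m : rand R T) (h : T -> rand R U) E :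
  prob (bind m h) E = \sum_(w <- m) w.1 * prob (h w.2) E.
Proof.
elim: m => [|w m IH]; first by rewrite /prob !big_nil.
rewrite big_cons -IH /bind allpairs_cons /prob big_cat big_map; congr (_ + _).
by rewrite big_distrr.
Qed.

Lemma prob_ret T (t : T) E : prob (ret R t) E = (E t)%:R.
Proof. by rewrite probE big_seq1 mul1r. Qed.

Lemma surely_distribution T (m : rand R T) :
  is_distribution m -> surely m (fun=> True).
Proof.
case=> m0 m1; split=> //; apply: sub_all m0 => w ->.
by apply/boolp.asboolP.
Qed.

Lemma surely_ret T (t : T) P : P t -> surely (ret R t) P.
Proof.
move=> Pt; split; last by rewrite prob_ret.
by rewrite /= ler01 andbT; apply/boolp.asboolP.
Qed.

Lemma surely_sum_le T (m : rand R T) P (F G : T -> R) :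
    surely m P -> (forall t, P t -> F t <= G t) ->
  \sum_(w <- m) w.1 * F w.2 <= \sum_(w <- m) w.1 * G w.2.
Proof.
case=> + _ FG; elim: m => [|w m IH] /=; first by rewrite !big_nil.
case/andP=> /andP[w0 /boolp.asboolP Pw] /IH mFG; rewrite !big_cons lerD //.
by rewrite ler_wpM2l ?FG.
Qed.

Lemma surely_sum_cst T (m : rand R T) P (a : R) :
  surely m P -> \sum_(w <- m) w.1 * a = a.
Proof.
by case=> _ m1; rewrite -big_distrl /= -[X in X * _]/(prob m xpredT) m1 mul1r.
Qed.

Lemma surely_weaken T (m : rand R T) (P Q : T -> Prop) :
  surely m P -> (forall t, P t -> Q t) -> surely m Q.
Proof.
case=> mP m1 PQ; split=> //; apply: sub_all mP => w /andP[-> /boolp.asboolP Pw].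
exact/boolp.asboolP/PQ.
Qed.

Lemma surely_prob_le T (m : rand R T) P (E E' : pred T) :
  surely m P -> (forall t, P t -> E t -> E' t) -> prob m E <= prob m E'.
Proof.
move=> mP EE'; rewrite !probE.
apply: (surely_sum_le mP (F := fun t => (E t)%:R) (G := fun t => (E' t)%:R)).
move=> t Pt.
by rewrite ler_nat; move: (EE' t Pt); case: (E t) => // ->.
Qed.

Lemma surely_prob_eq1 T (m : rand R T) P (E : pred T) :
  surely m P -> (forall t, P t -> E t) -> prob m E = 1.
Proof.
move=> mP PE; apply/le_anti; have [_ <-] := mP.
by rewrite !(surely_prob_le mP) // => t /PE.
Qed.

Lemma surely_prob_le1 T (m : rand R T) P (E : pred T) :
  surely m P -> prob m E <= 1.
Proof. by move=> mP; have [_ <-] := mP; apply: (surely_prob_le mP). Qed.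

Lemma prob_predC T (m : rand R T) P (E : pred T) :
  surely m P -> prob m (predC E) = 1 - prob m E.
Proof.
case=> _ <-; rewrite !probE -sumrB; apply: eq_bigr => w _ /=.
by case: (E w.2); rewrite ?mulr1 ?mulr0 ?subrr ?subr0.
Qed.

Lemma surely_bind T U (m : rand R T) (h : T -> rand R U) P Q :
  surely m P -> (forall t, P t -> surely (h t) Q) -> surely (bind m h) Q.
Proof.
move=> mP hQ; split; last first.
  rewrite prob_bind -[RHS](surely_sum_cst 1 mP); apply/le_anti/andP.
  by split; [apply: (surely_sum_le mP (F := fun t => prob (h t) _) (G := fun=> 1))
            |apply: (surely_sum_le mP (F := fun=> 1) (G := fun t => prob (h t) _))]
    => t /hQ[_ ->].
case: mP => + _; elim: m => [//|w m IH] /=.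
case/andP=> /andP[w0 /boolp.asboolP Pw] mP.
rewrite /bind allpairs_cons all_cat IH // andbT all_map.
by have [+ _] := hQ _ Pw; apply: sub_all => v /= /andP[v0 ->]; rewrite mulr_ge0.
Qed.

(** Union bound: either the first stage leaves [G], or the second stage fails from a good state. *)
Lemma prob_bind_le T U (m : rand R T) (h : T -> rand R U) P Q (G : pred T)
    E a b :
    surely m P -> (forall t, P t -> surely (h t) Q) ->
    prob m (predC G) <= a -> 0 <= b ->
    (forall t, P t -> G t -> prob (h t) E <= b) ->
  prob (bind m h) E <= a + b.
Proof.
move=> mP hQ ma b0 hE; rewrite prob_bind.
apply: (@le_trans _ _ (\sum_(w <- m) w.1 * ((predC G w.2)%:R + b))).
  apply: (surely_sum_le mP (F := fun t => prob (h t) E)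
                           (G := fun t => (predC G t)%:R + b)) => t Pt /=.
  have [Gt | Gt] := boolP (G t); first by rewrite add0r hE.
  by apply: (le_trans (surely_prob_le1 _ (hQ _ Pt))); rewrite lerDl.
under eq_bigr do rewrite mulrDr.
by rewrite big_split /= (surely_sum_cst _ mP) lerD2r; move: ma; rewrite probE.
Qed.

(** Loop rule with a sure invariant [I], a variant [v] that keeps the fuel from running out, and a
    property [G] that each pass breaks with probability at most [a]. *)
Lemma while_spec T (guard : T -> bool) (body : T -> rand R T)
    (I : T -> Prop) (G : pred T) (v : T -> nat) (a : R) :
    0 <= a ->
    (forall t, I t -> guard t ->
      surely (body t) (fun t' => I t' /\ (v t' < v t)%N)) ->
    (forall t, I t -> guard t -> G t -> prob (body t) (predC G) <= a) ->
  forall fuel t, I t -> (v t <= fuel)%N ->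
  surely (while fuel guard body t) (fun t' => I t' /\ ~~ guard t') /\
  (G t -> prob (while fuel guard body t) (predC G) <= fuel%:R * a).
Proof.
move=> a0 bodyI bodyG; elim=> [|fuel IH] t It vt /=.
  case: ifPn => [gt | ngt].
    (* Without fuel [v t] is 0 and cannot decrease, so the body would have no outcome, against its
       total mass 1. *)
    have : prob (body t) xpredT <= prob (body t) xpred0.
      apply: surely_prob_le (bodyI t It gt) _ => t' [_].
      by rewrite ltnNge (leq_trans vt).
    by have [_ ->] := bodyI t It gt; rewrite [leRHS]big_pred0_eq ler10.
  split; first exact: surely_ret.
  by move=> Gt; rewrite prob_ret /= Gt mul0r.
case: ifPn => [gt | ngt]; last first.
  split; first exact: surely_ret.
  by move=> Gt; rewrite prob_ret /= Gt mulr_ge0.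
have IH' t' : I t' /\ (v t' < v t)%N -> _ := fun h =>
  IH t' h.1 (leq_trans h.2 vt).
split; first by apply: surely_bind (bodyI t It gt) _ => t' /IH'[].
move=> Gt; rewrite -natr1 mulrDl mul1r addrC.
apply: prob_bind_le (bodyI t It gt) _ (bodyG t It gt Gt) _ _ => //.
- by move=> t' /IH'[+ _]; apply.
- by rewrite mulr_ge0.
- by move=> t' /IH'[_ +]; apply.
Qed.

End Randomized.

(** * Analysis of the algorithms *)

Section Algorithms.
Context {R : realType} {n : nat}.
Implicit Types (f g h : boolfun n) (A S : {set 'I_n}).

Lemma largestP A (e : 'I_n -> R) : A != finset.set0 ->
  exists i, [/\ largest A e = Some i, i \in A
              & forall j, j \in A -> e j <= e i].
Proof.
case/set0Pn=> i0 i0A; rewrite /largest; case: pickP => [i /andP[iA]|noi].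
  by move=> /forall_inP emax; exists i.
have [i iA emax] := Order.TotalTheory.arg_maxP e i0A.
by case/negP: (negbT (noi i)); apply/andP; split=> //; apply/forall_inP.
Qed.

Definition pass1 (est_crit : crit_estimator R n) (est_infl : infl_estimator R n)
    A (st : {set 'I_n} * boolfun n) : rand R ({set 'I_n} * boolfun n) :=
  let: (S0, h) := st in
  bind (est_crit h) (fun p => bind (est_infl h p) (fun e =>
    if largest (A :\: S0) e is Some i then
      let b := p < 2^-1 in
      ret R (i |: S0, restrict h [set i] [ffun=> b])
    else diverge R _)).

Definition reachable1 k A g (st : {set 'I_n} * boolfun n) : Prop :=
  [/\ st.1 \subset A, monotone st.2, (cert_complexity st.2 <= k)%N,
      junta st.2 (A :\: st.1) & exists z, st.2 = restrict g st.1 z].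

(* With accurate estimates every pass moves the critical probability by at least
   2u away from 1/2, always in the same direction; as it stays in [0, 1], this
   leaves room for at most 32 k^3 passes. *)
Definition on_track1 k (u : R) (st : {set 'I_n} * boolfun n) : bool :=
  (#|st.1| <= 32 * k ^ 3)%N &&
  [|| is_constant st.2, st.1 == finset.set0,
      2^-1 + #|st.1|.+1%:R * u <= critical_prob R st.2
    | critical_prob R st.2 <= 2^-1 - #|st.1|.+1%:R * u].

Lemma nonconstant_gt0 f k :
  (cert_complexity f <= k)%N -> ~~ is_constant f -> (0 < k)%N.
Proof.
rewrite lt0n => Cf nf; apply/eqP => k0; move: nf; rewrite k0 in Cf.
by rewrite (certs0 (x := [ffun=> false]) (cert_complexity_certs Cf) erefl).
Qed.

(** The step of [3 * u] measured from [p] is one of at least [2 * u] measured from the true critical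
    probability. Accuracy of [e] is assumed only for [p] in [0, 1], which is derived here. *)
Lemma on_track1_next k A S h i p (e : 'I_n -> R) :
    let u := 64^-1 / k%:R ^+ 3 in
    monotone h -> (cert_complexity h <= k)%N -> junta h (A :\: S) ->
    ~~ is_constant h -> on_track1 k u (S, h) ->
    `|p - critical_prob R h| <= u ->
    (0 <= p <= 1 -> forall j, `|e j - influence p h j| <= 64^-1 / k%:R ^+ 2) ->
    i \in A :\: S -> (forall j, j \in A :\: S -> e j <= e i) ->
  on_track1 k u (i |: S, restrict h [set i] [ffun=> p < 2^-1]).
Proof.
move=> u mh Ch hA nh /andP[/= Sk track] pP eP iAS emax.
have k0 := nonconstant_gt0 Ch nh.
have k1 : 1 <= k%:R :> R by rewrite ler1n.
have k3 : 0 < k%:R ^+ 3 :> R by rewrite exprn_gt0 // ltr0n.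
have u0 : 0 < u by rewrite divr_gt0 // invr_gt0.
have uk : k%:R ^+ 3 * u = 64^-1 by rewrite mulrCA divff ?mulr1 // gt_eqF.
have [c01 _] := critical_probP (R := R) mh nh.
have /andP[c0 c1] := c01.
have [cl cr] := critical_prob_gap (R := R) mh nh Ch.
set c := critical_prob R h in c01 c0 c1 cl cr pP track.
move: pP; rewrite ler_norml => /andP[pl pr].
(* The critical probability is at least [1 / (4 * k)], hence at least [u], away from 0 and 1. *)
have k2u : 4 * k%:R * u <= 1.
  by have : k%:R <= k%:R ^+ 3 :> R; [rewrite ler_eXnr | nra].
have p01 : 0 <= p <= 1 by apply/andP; split; nra.
have iNS : i \notin S by have := iAS; rewrite inE => /andP[].
have cS : #|i |: S| = #|S|.+1 by rewrite cardsU1 iNS.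
rewrite (negPf nh) /= in track.
rewrite /on_track1 /= cS; apply/andP; split.
  case/orP: track => [/eqP-> | track].
    by rewrite cards0 muln_gt0 expn_gt0 k0.
  (* The critical probability cannot leave [0, 1]; with [u = 1 / (64 * k^3)] this gives the bound
     [32 * k^3]. *)
  have : #|S|.+1%:R * u <= 2^-1 by case/orP: track; lra.
  rewrite -(ler_nat R) natrM natrX => Su.
  rewrite -(ler_pM2r u0) -mulrA uk; lra.
case: (boolP (is_constant _)) => //= nh'.
apply/orP; right.
have := critical_prob_step mh nh Ch k0 p01 _ (eP p01) iAS emax hA nh'.
rewrite -/u -/c; set c' := critical_prob R _.
have pc : `|p - c| <= u by rewrite ler_norml pl pr.
move=> /(_ pc).
rewrite -natr1; move: track; rewrite -natr1.
(* The first pass chooses the side of 1/2. Later the distance from 1/2 exceeds the error [u], so [p]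
   lies on the same side. *)
have [S0 | SN0] := eqVneq S finset.set0.
  rewrite S0 cards0 /= => _; case: ltP => pl2 cc'; apply/orP; [right|left]; lra.
have m1 : 1 <= #|S|%:R :> R by rewrite ler1n card_gt0.
set m := #|S|%:R in m1 *.
have mu : u <= m * u by rewrite ler_peMl // ltW.
move=> /= track; case: ltP => pl2 cc'; apply/orP; [right|left];
  by case/orP: track => ?; lra.
Qed.

(** A nonconstant [h] depends on some free coordinate, so [largest] succeeds and one coordinate
    leaves [A :\: S]. *)
Lemma pass1_surely k est_crit est_infl A g st eps1 delta1 eps2 delta2 :
    accurate_crit k eps1 delta1 est_crit ->
    accurate_infl k eps2 delta2 est_infl ->
    reachable1 k A g st -> ~~ is_constant st.2 ->
  surely (pass1 est_crit est_infl A st)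
    (fun st' => reachable1 k A g st' /\ (#|A :\: st'.1| < #|A :\: st.1|)%N).
Proof.
case: st => S h [ec _] [ei _] [/= SA mh Ch hA [z hE]] nh.
apply: surely_bind (surely_distribution (ec h)) _ => p _.
apply: surely_bind (surely_distribution (ei h p)) _ => e _.
have AS : A :\: S != finset.set0.
  by apply: contraNneq nh => AS0; apply: junta0; rewrite -AS0.
have [i [-> iAS _]] := largestP e AS.
have setE : A :\: (i |: S) = (A :\: S) :\ i.
  by apply/setP => j; rewrite !inE negb_or -andbA.
apply: surely_ret; split; last by rewrite /= setE [ltnRHS](cardsD1 i) iAS.
split=> /=.
- by rewrite subUset sub1set SA andbT; move: iAS; rewrite inE => /andP[].
- exact: monotone_restrict.
- exact: cert_complexity_restrict.
- by rewrite setE; apply: junta_restrict.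
- by eexists; rewrite hE restrict_restrict setUC.
Qed.

(** Each of the two estimators contributes one [delta]. *)
Lemma pass1_on_track k est_crit est_infl A g st delta :
    let u := 64^-1 / k%:R ^+ 3 in
    0 <= delta -> accurate_crit k u delta est_crit ->
    accurate_infl k (64^-1 / k%:R ^+ 2) delta est_infl ->
    reachable1 k A g st -> ~~ is_constant st.2 -> on_track1 k u st ->
  prob (pass1 est_crit est_infl A st) (predC (on_track1 k u)) <= 2 * delta.
Proof.
case: st => S h u d0 [ec ecP] [ei eiP] [/= SA mh Ch hA _] nh track.
have AS : A :\: S != finset.set0.
  by apply: contraNneq nh => AS0; apply: junta0; rewrite -AS0.
have cdist := surely_distribution (ec h).
have idist p := surely_distribution (ei h p).
pose next (p : R) (e : 'I_n -> R) : rand R ({set 'I_n} * boolfun n) :=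
  if largest (A :\: S) e is Some i then
    ret R (i |: S, restrict h [set i] [ffun=> p < 2^-1])
  else diverge R _.
have nextS p e : surely (next p e) (fun=> True).
  by rewrite /next; have [i [-> _ _]] := largestP e AS; apply: surely_ret.
have stepS p : surely (bind (est_infl h p) (next p)) (fun=> True).
  by apply: surely_bind (idist p) _ => e _; apply: nextS.
rewrite (_ : 2 * delta = delta + delta); last by rewrite mulr_natl.
apply: (prob_bind_le (Q := fun=> True)
  (G := fun p => `|p - critical_prob R h| <= u) cdist) => //.
- by move=> p _; apply: stepS.
- by rewrite (prob_predC _ cdist); have := ecP h mh Ch nh; lra.
move=> p _ pP; rewrite -[leRHS]addr0.
(* The good event is conditional on [p] in [0, 1], since accuracy of the influences is promised only
   there. *)
apply: (prob_bind_le (Q := fun=> True) (h := next p)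
  (G := fun e => (0 <= p <= 1) ==>
    [forall j, `|e j - influence p h j| <= 64^-1 / k%:R ^+ 2])
  (idist p)) => //.
- have [p01 | p01] := boolP (0 <= p <= 1).
    by rewrite (prob_predC _ (idist p)); have := eiP h p mh Ch nh p01; lra.
  by rewrite (prob_predC _ (idist p)) (surely_prob_eq1 (idist p)) ?subrr.
move=> e _ eP; rewrite /next; have [i [-> iAS emax]] := largestP e AS.
have eP' : 0 <= p <= 1 ->
    forall j, `|e j - influence p h j| <= 64^-1 / k%:R ^+ 2.
  by move=> p01; apply/forallP; move: eP; rewrite p01.
by rewrite prob_ret /= (on_track1_next mh Ch hA nh track pP eP' iAS emax).
Qed.

(** The first conclusion is sure; only the size bound rests on the accuracy of the estimates, lost
    with probability at most [2 * delta] in each of at most [n] passes. *)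
Lemma algorithm1_spec k (est_crit : crit_estimator R n)
    (est_infl : infl_estimator R n) A g delta :
    0 <= delta -> accurate_crit k (64^-1 / k%:R ^+ 3) delta est_crit ->
    accurate_infl k (64^-1 / k%:R ^+ 2) delta est_infl ->
    monotone g -> (cert_complexity g <= k)%N -> junta g A ->
  surely (algorithm1 est_crit est_infl A g)
    (fun S => S \subset A /\ exists z, is_constant (restrict g S z)) /\
  prob (algorithm1 est_crit est_infl A g) (fun S => ~~ (#|S| <= 32 * k ^ 3)%N)
    <= n%:R * (2 * delta).
Proof.
move=> d0 ec ei mg Cg gA.
pose I := reachable1 k A g.
have I0 : I (finset.set0, g).
  split=> //=; first exact: sub0set.
    by rewrite setD0.
  by exists [ffun=> false]; rewrite restrict0.
have vn : (#|A :\: finset.set0| <= n)%N.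
  by rewrite -[leqRHS]card_ord max_card.
have d20 : 0 <= 2 * delta by rewrite mulr_ge0.
have [wS wG] := while_spec (guard := fun st => ~~ is_constant st.2)
  (v := fun st => #|A :\: st.1|) (body := pass1 est_crit est_infl A) d20
  (fun st It => pass1_surely ec ei (st := st) It)
  (fun st It => pass1_on_track d0 ec ei (st := st) It) I0 vn.
have {}wG := wG _.
have wT : surely (algorithm1 est_crit est_infl A g)
    (fun S => S \subset A /\ exists z, is_constant (restrict g S z)).
  apply: surely_bind wS _ => st [[SA _ _ _ [z stE]] /negPn cst].
  by apply: surely_ret; split=> //; exists z; rewrite -stE.
split=> //; rewrite -[leRHS]addr0; apply: prob_bind_le wS _ (wG _) _ _ => //.
- by move=> st _; apply: (surely_ret (P := fun=> True)).
- by rewrite /on_track1 cards0 eqxx orbT.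
- by move=> st _ /andP[Sk _]; rewrite prob_ret Sk.
Qed.

End Algorithms.

(** * The second algorithm *)

Section Algorithm2.
Context {R : realType} {n : nat}.
Implicit Types (f g h : boolfun n) (A S : {set 'I_n}).

Definition pass2 (est_crit : crit_estimator R n) (est_infl : infl_estimator R n)
    (xstar : cube n) (st : state2 n) : rand R (state2 n) :=
  bind (algorithm1 est_crit est_infl (~: chosen st) (current st)) (fun s =>
    ret R (State2 (chosen st :|: s) (restrict (current st) s xstar)
                  (iterations st).+1)).

(** The two one-sided certificate bounds serve as a potential: starting from [k + k], their sum pays
    for the passes. *)
Definition reachable2 k f xstar (st : state2 n) : Prop :=
  [/\ monotone (current st) /\ (cert_complexity (current st) <= k)%N,
      junta (current st) (~: chosen st),
      current st = restrict f (chosen st) xstar &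
      exists a0 a1, [/\ certs (current st) false a0, certs (current st) true a1
                      & (a0 + a1 + iterations st <= 2 * k)%N]].

Lemma pass2_surely k est_crit est_infl f xstar delta st :
    0 <= delta -> accurate_crit k (64^-1 / k%:R ^+ 3) delta est_crit ->
    accurate_infl k (64^-1 / k%:R ^+ 2) delta est_infl ->
    reachable2 k f xstar st -> ~~ is_constant (current st) ->
  surely (pass2 est_crit est_infl xstar st)
    (fun st' => reachable2 k f xstar st'
                /\ (#|~: chosen st'| < #|~: chosen st|)%N).
Proof.
case: st => S h it d0 ec ei [/= [mh Ch] hS hE [a0 [a1 [C0 C1 ak]]]] nh.
have [alg1 _] := algorithm1_spec d0 ec ei mh Ch hS.
apply: surely_bind alg1 _ => s [sS [z cz]]; apply: surely_ret.
have setE : ~: (S :|: s) = ~: S :\: s by rewrite setCU setDE.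
split; last first.
  rewrite /= setE cardsDS // ltn_subrL !card_gt0.
  have s0 : s != finset.set0.
    by apply: contraNneq nh => s0; rewrite s0 restrict0 in cz.
  by rewrite s0; apply: contraNneq s0 => S0; rewrite -subset0 -S0.
split=> /=.
- by split; [apply: monotone_restrict | apply: cert_complexity_restrict].
- by rewrite setE; apply: junta_restrict.
- rewrite hE restrict_restrict; congr restrict; apply/ffunP => i.
  by rewrite overwriteE if_same.
(* Both bounds are positive for a nonconstant function, so a predecessor is a true decrease. *)
have pos v a : certs h v a -> (0 < a)%N.
  have [x hx] := nonconstantP v nh.
  by case: a => // Ca; rewrite (certs0 Ca hx) in nh.
have a0_gt0 := pos _ _ C0; have a1_gt0 := pos _ _ C1.
have zE x : restrict h s z x = restrict h s z [ffun=> false].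
  by move/is_constantP: cz.
(* Certificates of the value opposite to the one forced by [z] lose a coordinate when [s] is fixed
   according to [xstar]. *)
case zv: (restrict h s z [ffun=> false]) zE => zE.
- exists a0.-1, a1; split; [|exact: certs_restrict | lia].
  exact: (certs_restrict_pred (v := false) zE C0).
- exists a0, a1.-1; split; [exact: certs_restrict | | lia].
  exact: (certs_restrict_pred (v := true) zE C1).
Qed.

Lemma pass2_small k est_crit est_infl f xstar delta st :
    let small (st : state2 n) :=
      (#|chosen st| <= 32 * k ^ 3 * iterations st)%N in
    0 <= delta -> accurate_crit k (64^-1 / k%:R ^+ 3) delta est_crit ->
    accurate_infl k (64^-1 / k%:R ^+ 2) delta est_infl ->
    reachable2 k f xstar st -> small st ->
  prob (pass2 est_crit est_infl xstar st) (predC small) <= n%:R * (2 * delta).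
Proof.
case: st => S h it small d0 ec ei [/= [mh Ch] hS _ _]; rewrite /small /= => Sit.
have [alg1 alg1_small] := algorithm1_spec d0 ec ei mh Ch hS.
rewrite /pass2 /= -[leRHS]addr0.
apply: (prob_bind_le (Q := fun=> True)
  (G := fun s : {set 'I_n} => (#|s| <= 32 * k ^ 3)%N) alg1) => //.
  by move=> s _; apply: surely_ret.
move=> s _ sk; rewrite prob_ret /= mulnS addnC.
by rewrite (leq_trans (leq_card_setU _ _)) // leq_add.
Qed.

Lemma algorithm2_spec k (est_crit : crit_estimator R n)
    (est_infl : infl_estimator R n) f xstar delta :
    0 <= delta -> accurate_crit k (64^-1 / k%:R ^+ 3) delta est_crit ->
    accurate_infl k (64^-1 / k%:R ^+ 2) delta est_infl ->
    monotone f -> (cert_complexity f <= k)%N ->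
  let run := algorithm2 est_crit est_infl f xstar in
  surely run (fun st => is_certificate f xstar (chosen st)
                        /\ (iterations st <= 2 * k)%N) /\
  prob run (fun st => ~~ (#|chosen st| <= 32 * k ^ 3 * iterations st)%N)
    <= n%:R * (n%:R * (2 * delta)).
Proof.
move=> d0 ec ei mf Cf run.
have I0 : reachable2 k f xstar (State2 finset.set0 f 0).
  split=> //=; rewrite ?restrict0 //.
    rewrite setC0 => x y xy; congr f.
    by apply/ffunP => i; apply: xy; rewrite inE.
  exists k, k; split; try exact: cert_complexity_certs.
  by rewrite addn0 mul2n addnn.
have vn : (#|~: chosen (State2 (n := n) finset.set0 f 0)| <= n)%N.
  by rewrite -[leqRHS]card_ord max_card.
have nd0 : 0 <= n%:R * (2 * delta) by rewrite !mulr_ge0.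
have [wS wG] := while_spec (guard := fun st => ~~ is_constant (current st))
  (v := fun st => #|~: chosen st|) (body := pass2 est_crit est_infl xstar) nd0
  (fun st It => pass2_surely d0 ec ei (st := st) It)
  (fun st It _ => pass2_small d0 ec ei (st := st) It) I0 vn.
split; last by apply: wG; rewrite /= cards0.
apply: surely_weaken wS _ => st [[_ _ stE [a0 [a1 [_ _ ak]]]] /negPn cst].
split.
  apply/is_certificateP => y yx; move/is_constantP: cst => /(_ y xstar).
  rewrite stE /restrict; congr (f _ = f _); apply/ffunP => i;
    rewrite overwriteE.
    by case: ifP => // iS; rewrite yx.
  by rewrite if_same.
by rewrite (leq_trans _ ak) // leq_addl.
Qed.

End Algorithm2.

(** The constants are absolute. High probability means [1 - n^-d] for any prescribed [d], given
    estimators whose failure probability [n^-e] has [e] depending only on [d]. *)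
Theorem theorem6 (R : realType) :
  exists (c : R) (K1 K2 : nat), 0 < c /\
  forall d : nat, exists e : nat,
  forall (n k : nat) (f : boolfun n) (xstar : cube n)
         (est_crit : crit_estimator R n) (est_infl : infl_estimator R n),
    monotone f ->
    (cert_complexity f <= k)%N ->
    accurate_crit k (c / k%:R ^+ 3) (n%:R ^- e) est_crit ->
    accurate_infl k (c / k%:R ^+ 2) (n%:R ^- e) est_infl ->
    let run := algorithm2 est_crit est_infl f xstar in
    prob run (fun out => (iterations out <= K1 * k)%N) = 1 /\
    1 - n%:R ^- d <=
      prob run (fun out => is_certificate f xstar (chosen out)
                           && (#|chosen out| <= K2 * k ^ 4)%N).
Proof.
(* At most [2 * k] passes, each adding at most [32 * k^3] coordinates, give [64 * k^4]. *)
exists 64^-1, 2, 64; split; first by rewrite invr_gt0.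
(* The failure bound [2 * n^2 * n^-(d + 3)] equals [n^-d * (2 / n)], at most [n^-d] once
   [n >= 2]. *)
move=> d; exists (d + 3)%N => n k f xstar est_crit est_infl mf Cf ec ei run.
have d0 : 0 <= n%:R ^- (d + 3) :> R by rewrite invr_ge0 exprn_ge0.
have [runS run_small] := algorithm2_spec xstar d0 ec ei mf Cf.
split; first by apply: surely_prob_eq1 runS _ => st [].
rewrite lerBlDr -lerBlDl -(prob_predC _ runS).
apply: (@le_trans _ _ (prob run
  (fun st => ~~ (#|chosen st| <= 32 * k ^ 3 * iterations st)%N))).
  apply: surely_prob_le runS _ => st [cst itk] /=; rewrite cst /=.
  apply: contraNN => small.
  apply: (leq_trans small); rewrite (expnSr k 3).
  by have := leq_mul (leqnn (k ^ 3)) itk; move: (k ^ 3)%N => X; lia.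
(* For [n = 0] the failure bound vanishes; for [n = 1] the allowed failure probability is 1. *)
have [n2 | n1] := ltnP 1 n; last first.
  have [n0 | n0] := posnP n.
    by apply: (le_trans run_small); rewrite {1}n0 mul0r invr_ge0 exprn_ge0.
  have -> : n%:R = 1 :> R by apply/eqP; rewrite pnatr_eq1 eqn_leq n1.
  by rewrite expr1n invr1; apply: surely_prob_le1 runS.
apply: (le_trans run_small).
have n0 : 0 < n%:R :> R by rewrite ltr0n ltnW.
rewrite exprD invfM; set X := n%:R ^- d.
have X0 : 0 <= X by rewrite invr_ge0 exprn_ge0.
have -> : n%:R * (n%:R * (2 * (X * n%:R ^- 3))) = X * (2 / n%:R) :> R.
  by field; rewrite gt_eqF.
by rewrite ler_piMr // ler_pdivrMr // mul1r ler_nat.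
Qed.
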